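(* Let $n\ge1$. An element $\sigma\in\bar U(n)$ satisfies the system $$\Delta_i\Delta_j\big(\tilde h_{ij}\,\sigma\big)=0,\qquad i,j=1,\dots,n,$$ if and only if $\sigma\in\mathcal W$, that is, if and only if $\sigma=\sum_{j=1}^n\pi_j(\tilde h_j)/\chi_j$ for some univariate polynomials $\pi_1,\dots,\pi_n$ over $\mathbb K$.
   Context: $\mathbb K$ is a field of characteristic $0$. $U(n)=\mathbb K[\tilde h_1,\dots,\tilde h_n]$ is the commutative polynomial ring, $\tilde h_{ij}=\tilde h_i-\tilde h_j$, and $\bar U(n)$ is the localization of $U(n)$ with respect to the multiplicative set generated by all $\tilde h_{ij}+a$, $a\in\mathbb Z$, $i\ne j$. For $p\in\bar U(n)$, $p[-\varepsilon_j]$ denotes the image of $p$ under the automorphism $\tilde h_i\mapsto\tilde h_i-\delta_{ij}$ ($i=1,\dots,n$). $\Delta_j f:=f-f[-\varepsilon_j]$. $\chi_j:=\prod_{k\ne j}\tilde h_{jk}$. $\mathcal W_j$ is the $\mathbb K$-vector space of elements $\pi(\tilde h_j)/\chi_j\in\bar U(n)$ with $\pi$ a univariate polynomial over $\mathbb K$, and $\mathcal W:=\sum_{j=1}^n\mathcal W_j$. *)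

(* Defs.v *)
From HB Require Import structures.
From mathcomp Require Import all_boot all_order all_algebra.
From mathcomp.multinomials Require Export mpoly.

Set Implicit Arguments.
Unset Strict Implicit.
Unset Printing Implicit Defensive.

Import GRing.Theory.
Local Open Scope ring_scope.

Notation U K n := {mpoly K[n]}.
Notation FracU K n := {fraction {mpoly K[n]}}.

Section Defs.

Variables (K : fieldType) (n : nat).
Implicit Types (i j : 'I_n) (p q s : U K n) (x y : FracU K n).

Inductive denominator : U K n -> Prop :=
| denominator1 : denominator 1
| denominatorM i j (a : int) s :
    i != j -> denominator s -> denominator (('X_i - 'X_j + a%:~R) * s).

(* The localization of the domain U K n at [denominator] (which does not
   contain 0, see [denominator_neq0]), as a subring of the field of fractions. *)
Definition Ubar x : Prop :=
  exists p s, denominator s /\ x = tofrac p / tofrac s.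

Definition h i : FracU K n := tofrac 'X_i.

Definition shiftU j p : U K n :=
  p \mPo [tuple 'X_i - (i == j)%:R | i < n].

(* x[-eps_j].  By [shift_div] the value does not depend on the fraction that
   represents x. *)
Definition shift j x : FracU K n :=
  tofrac (shiftU j \n_(repr x)) / tofrac (shiftU j \d_(repr x)).

Definition Delta j x : FracU K n := x - shift j x.

Definition chi j : FracU K n := \prod_(k < n | k != j) (h j - h k).

Definition eval_h (p : {poly K}) j : FracU K n := tofrac (horner_alg 'X_j p).

Definition Wj j x : Prop :=
  Ubar x /\ exists p : {poly K}, x = eval_h p j / chi j.

Definition W x : Prop :=
  exists w : 'I_n -> FracU K n, (forall j, Wj j (w j)) /\ x = \sum_(j < n) w j.

Lemma shiftUX i j : shiftU j 'X_i = 'X_i - (i == j)%:R.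
Proof. by rewrite /shiftU comp_mpolyXU -tnth_nth tnth_mktuple. Qed.

Lemma shiftUC j c : shiftU j c%:MP = c%:MP.
Proof. exact: comp_mpolyC. Qed.

Lemma shiftU_is_zmod j : zmod_morphism (shiftU j).
Proof. by move=> p q; rewrite /shiftU raddfB. Qed.

Lemma shiftU_is_monoid j : monoid_morphism (shiftU j).
Proof. by split=> [|p q]; rewrite /shiftU ?rmorph1 ?rmorphM. Qed.

HB.instance Definition _ j :=
  GRing.isZmodMorphism.Build _ _ (shiftU j) (shiftU_is_zmod j).
HB.instance Definition _ j :=
  GRing.isMonoidMorphism.Build _ _ (shiftU j) (shiftU_is_monoid j).

Definition unshiftU j p : U K n :=
  p \mPo [tuple 'X_i + (i == j)%:R | i < n].

Lemma comp_mpolyA (t u : n.-tuple (U K n)) p :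
  (p \mPo t) \mPo u = p \mPo [tuple tnth t i \mPo u | i < n].
Proof.
rewrite [p \mPo t]comp_mpolyE [RHS]comp_mpolyE raddf_sum /=.
apply: eq_bigr => m _.
rewrite comp_mpolyZ; congr (_ *: _); rewrite rmorph_prod.
by apply: eq_bigr => i _; rewrite rmorphXn /= tnth_mktuple.
Qed.

Lemma shiftUK j : cancel (shiftU j) (unshiftU j).
Proof.
move=> p; rewrite /shiftU /unshiftU comp_mpolyA -[RHS]comp_mpoly_id.
congr (_ \mPo _); apply: eq_from_tnth => i; rewrite !tnth_mktuple.
by rewrite rmorphB rmorph_nat /= comp_mpolyXU -tnth_nth tnth_mktuple addrK.
Qed.

Lemma unshiftUK j : cancel (unshiftU j) (shiftU j).
Proof.
move=> p; rewrite /shiftU /unshiftU comp_mpolyA -[RHS]comp_mpoly_id.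
congr (_ \mPo _); apply: eq_from_tnth => i; rewrite !tnth_mktuple.
by rewrite rmorphD rmorph_nat /= comp_mpolyXU -tnth_nth tnth_mktuple subrK.
Qed.

Lemma shiftU_eq0 j p : (shiftU j p == 0) = (p == 0).
Proof. exact: raddf_eq0 (can_inj (shiftUK j)). Qed.

Lemma frac_repr x : x = tofrac \n_(repr x) / tofrac \d_(repr x).
Proof.
have d0 : tofrac \d_(repr x) != 0 by rewrite tofrac_eq0 denom_ratioP.
apply: (mulIf d0); rewrite divfK //.
rewrite -{1}[x]reprK; unlock FracField.tofrac.
rewrite -[LHS]FracField.pi_mul; apply/eqmodP.
rewrite /= FracField.equivfE /FracField.mulf !numden_Ratio ?mulr1 ?oner_eq0 ?denom_ratioP //.
by rewrite mulrC.
Qed.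

Lemma shift_div j p q : q != 0 ->
  shift j (tofrac p / tofrac q) = tofrac (shiftU j p) / tofrac (shiftU j q).
Proof.
move=> q0; rewrite /shift.
apply/eqP; rewrite eqr_div ?tofrac_eq0 ?shiftU_eq0 ?denom_ratioP //.
rewrite -!tofracM tofrac_eq -!rmorphM /=; apply/eqP; congr (shiftU j _).
apply/eqP; rewrite -tofrac_eq !tofracM -eqr_div ?tofrac_eq0 ?denom_ratioP //.
by rewrite -frac_repr.
Qed.

Lemma shift_tofrac j p : shift j (tofrac p) = tofrac (shiftU j p).
Proof.
by rewrite -[in LHS](divr1 (tofrac p)) -tofrac1 shift_div ?oner_eq0 // rmorph1
           tofrac1 divr1.
Qed.

Lemma shift_is_zmod j : zmod_morphism (shift j).
Proof.
move=> x y; rewrite [x]frac_repr [y]frac_repr.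
set a := \n_ _; set b := \d_ _; set c := \n_ _; set d := \d_ _.
have b0 : b != 0 by exact: denom_ratioP.
have d0 : d != 0 by exact: denom_ratioP.
rewrite -mulNr addf_div ?tofrac_eq0 // -tofracN -!tofracM -tofracD.
rewrite !shift_div ?mulf_neq0 // -mulNr addf_div ?tofrac_eq0 ?shiftU_eq0 //.
by rewrite !rmorphD /= !rmorphM /= !rmorphN.
Qed.

Lemma shift_is_monoid j : monoid_morphism (shift j).
Proof.
split=> [|x y]; first by rewrite -tofrac1 shift_tofrac rmorph1.
rewrite [x]frac_repr [y]frac_repr.
set a := \n_ _; set b := \d_ _; set c := \n_ _; set d := \d_ _.
have b0 : b != 0 by exact: denom_ratioP.
have d0 : d != 0 by exact: denom_ratioP.
by rewrite mulf_div -!tofracM !shift_div ?mulf_neq0 // mulf_div !rmorphM.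
Qed.

HB.instance Definition _ j :=
  GRing.isZmodMorphism.Build _ _ (shift j) (shift_is_zmod j).
HB.instance Definition _ j :=
  GRing.isMonoidMorphism.Build _ _ (shift j) (shift_is_monoid j).

Lemma shift_h i j : shift j (h i) = h i - (i == j)%:R.
Proof. by rewrite shift_tofrac shiftUX rmorphB rmorph_nat. Qed.

Lemma denominator_neq0 s : denominator s -> s != 0.
Proof.
elim=> [|i j a t ij _ t0]; first exact: oner_neq0.
apply: mulf_neq0 t0; apply/eqP => /(congr1 (mcoeff U_(i))).
rewrite -mpolyC1 -[_%:MP *~ _]raddfMz /= mcoeffD mcoeffB !mcoeffXU mcoeffC.
rewrite mnm1_eq0 mcoeff0 eqxx eq_sym (negPf ij) subr0 mulr0 addr0.
by apply/eqP; exact: oner_neq0.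
Qed.

Lemma denominator_shift j s : denominator s -> denominator (shiftU j s).
Proof.
elim=> [|i k a t ik _ IH]; first by rewrite rmorph1; exact: denominator1.
rewrite rmorphM rmorphD rmorphB rmorph_int /= !shiftUX.
pose b : int := a - (i == j)%:R + (k == j)%:R.
suff -> : 'X_i - (i == j)%:R - ('X_k - (k == j)%:R) + a%:~R
          = 'X_i - 'X_k + b%:~R :> U K n by exact: denominatorM.
rewrite /b rmorphD rmorphB /= !rmorph_nat opprB !addrA.
by rewrite (ACl (1*4*5*2*3))%AC.
Qed.

Lemma Ubar_shift j x : Ubar x -> Ubar (shift j x).
Proof.
move=> [p [s [ds ->]]]; rewrite shift_div ?denominator_neq0 //.
by exists (shiftU j p), (shiftU j s); split=> //; apply: denominator_shift.
Qed.

End Defs.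

(* Main.v *)
(* That [pi (h k) / chi k] solves the system is a partial fraction computation
   in the variables h i and h j.  For the converse, [Delta_i Delta_j f = 0] for
   a rational function f forces, since a polynomial over a domain of
   characteristic 0 that vanishes at all natural numbers is zero,
     f(x, y) - f(x', y) - f(x, y') + f(x', y') = 0
   for all values x, x' of h i and y, y' of h j.  Taken at
   f = (h i - h j) sigma and on the hyperplane h j = h i + a, this shows that
   all poles of sigma are killed by the Vandermonde product V of the
   differences h i - h j.  Taken at constants x', y', it shows that a solution
   is determined by its restrictions to the lines through a point c with
   distinct coordinates along which only one coordinate varies; the pi j are
   then obtained by interpolation from these restrictions. *)
Require Import Defs.
From mathcomp Require Import all_boot all_order all_algebra.
From mathcomp Require Import ring.
Import GRing.Theory.
Local Open Scope ring_scope.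

Set Implicit Arguments.
Unset Strict Implicit.
Unset Printing Implicit Defensive.

(* Otherwise unification unfolds these down to fractions of polynomials. *)
Local Opaque shift shiftU.

(** * Evaluation of polynomials and its compatibility with shifts *)

Definition upd (n : nat) (T : Type) (w : 'I_n -> T) (i : 'I_n) (x : T) :
  'I_n -> T := fun k => if k == i then x else w k.

Section Evaluation.

Variables (K : fieldType) (n : nat).

Lemma mpoly_rmorph_eq (A : comNzRingType)
    (f g : {rmorphism {mpoly K[n]} -> A}) :
  (forall c, f c%:MP = g c%:MP) -> (forall i, f 'X_i = g 'X_i) -> f =1 g.
Proof.
move=> fgC fgX p; rewrite [p]mpolyE !rmorph_sum; apply: eq_bigr => m _ /=.
rewrite -mul_mpolyC !rmorphM fgC; congr (_ * _).
rewrite mpolyXE_id !rmorph_prod; apply: eq_bigr => i _ /=.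
by rewrite !rmorphXn /= fgX.
Qed.

Lemma mmapXi (A : comNzRingType) (iota : {rmorphism K -> A}) w i :
  mmap iota w ('X_i : {mpoly K[n]}) = w i.
Proof. by rewrite mmapX mmap1U. Qed.

Lemma eq_mmap (A : comNzRingType) (iota : {rmorphism K -> A}) w1 w2
    (p : {mpoly K[n]}) :
  w1 =1 w2 -> mmap iota w1 p = mmap iota w2 p.
Proof.
move=> eqw; rewrite /mmap; apply: eq_bigr => m _; congr (_ * _).
exact: mmap1_eq.
Qed.

Lemma rmorph_mmap (A B : comNzRingType) (iA : {rmorphism K -> A})
    (iB : {rmorphism K -> B}) (f : {rmorphism A -> B}) w p :
  (forall c, f (iA c) = iB c) ->
  f (mmap iA w p) = mmap iB (f \o w) (p : {mpoly K[n]}).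
Proof.
move=> fi.
apply: (mpoly_rmorph_eq (f := f \o mmap iA w) (g := mmap iB (f \o w))).
  by move=> c /=; rewrite !mmapC fi.
by move=> i /=; rewrite !mmapXi.
Qed.

Lemma mmap_id (p : {mpoly K[n]}) : mmap (@mpolyC n K) (fun i => 'X_i) p = p.
Proof.
apply: (mpoly_rmorph_eq (f := mmap (@mpolyC n K) (fun i => 'X_i)) (g := idfun)).
  by move=> c /=; rewrite mmapC.
by move=> i /=; rewrite mmapXi.
Qed.

Lemma mmap_shiftU (A : comNzRingType) (iota : {rmorphism K -> A}) w j
    (p : {mpoly K[n]}) :
  mmap iota w (shiftU j p) = mmap iota (upd w j (w j - 1)) p.
Proof.
apply: (mpoly_rmorph_eq (f := mmap iota w \o @shiftU K n j)
   (g := mmap iota (upd w j (w j - 1)))) => [c|i] /=.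
  by rewrite shiftUC !mmapC.
rewrite shiftUX rmorphB rmorph_nat /= !mmapXi /upd.
by case: eqP => [->|_] //; rewrite subr0.
Qed.

(** This turns an identity between iterated shifts into values at translates of a point by natural
    numbers, which are infinitely many in characteristic 0. *)
Lemma mmap_iter_shiftU (A : comNzRingType) (iota : {rmorphism K -> A}) w j k
    (p : {mpoly K[n]}) :
  mmap iota w (iter k (@shiftU K n j) p) =
  mmap iota (upd w j (w j - k%:R)) p.
Proof.
elim: k w => [|k IH] w /=.
  by apply: eq_mmap => i; rewrite /upd subr0; case: eqP => [->|].
rewrite mmap_shiftU IH; apply: eq_mmap => i; rewrite /upd eqxx.
by case: eqP => // _; rewrite -addrA -opprD -natr1 addrC [1 + _]addrC addrC.
Qed.

(** The inner [mmap] is the restriction of [p] to the line through [w] in direction [i], seen as a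
    univariate polynomial; root counting can then be applied to it. *)
Lemma horner_slice (A : comNzRingType) (iota : {rmorphism K -> A}) w i
    (p : {mpoly K[n]}) x :
  (mmap (polyC \o iota) (upd (polyC \o w) i 'X) p).[x] =
  mmap iota (upd w i x) p.
Proof.
rewrite -horner_evalE (@rmorph_mmap _ _ _ iota) => [|c] /=; last first.
  by rewrite horner_evalE hornerC.
apply: eq_mmap => k; rewrite /upd /= horner_evalE.
by case: eqP; rewrite ?hornerX ?hornerC.
Qed.

Lemma shiftUC_comm i j (p : {mpoly K[n]}) :
  shiftU i (shiftU j p) = shiftU j (shiftU i p).
Proof.
apply: (mpoly_rmorph_eq (f := @shiftU K n i \o @shiftU K n j)
   (g := @shiftU K n j \o @shiftU K n i)) => [c|k] /=.
  by rewrite !shiftUC.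
by rewrite !shiftUX !rmorphB !rmorph_nat /= !shiftUX addrAC.
Qed.

Lemma shift_comm i j (x : {fraction {mpoly K[n]}}) :
  shift i (shift j x) = shift j (shift i x).
Proof.
rewrite [x]frac_repr; set q := \n_ _; set s := \d_ _.
have s0 : s != 0 by exact: denom_ratioP.
clearbody q s; rewrite (shift_div j q s0) (shift_div i q s0).
have [si sj] : shiftU i s != 0 /\ shiftU j s != 0 by rewrite !shiftU_eq0.
rewrite (shift_div i _ sj) (shift_div j _ si).
by rewrite (shiftUC_comm i j q) (shiftUC_comm i j s).
Qed.

Lemma iter_shiftU_eq0 k i (p : {mpoly K[n]}) :
  (iter k (@shiftU K n i) p == 0) = (p == 0).
Proof. by elim: k => //= k IH; rewrite shiftU_eq0. Qed.

Lemma iter_shift_div k i (q s : {mpoly K[n]}) : s != 0 ->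
  iter k (@shift K n i) (tofrac q / tofrac s) =
  tofrac (iter k (@shiftU K n i) q) / tofrac (iter k (@shiftU K n i) s).
Proof.
move=> s0; elim: k => [//|k IH].
by rewrite !iterS IH shift_div // iter_shiftU_eq0.
Qed.

End Evaluation.

(** * The four-point identity *)

Section FourPoint.

Variables (K : fieldType) (n : nat).
Hypothesis charK : [pchar K] =i pred0.

(** Since [iota] carries characteristic 0 from [K] to [L], the points [a - k%:R] are pairwise
    distinct, and [size g] of them are too many roots for a nonzero [g]. *)
Lemma poly_shifts_eq0 (L : idomainType) (iota : {rmorphism K -> L}) a
    (g : {poly L}) :
  (forall k, g.[a - k%:R] = 0) -> g = 0.
Proof.
move=> g0; apply/eqP; apply: contraT => gn0.
have := max_poly_roots (rs := mkseq (fun k => a - k%:R) (size g)) gn0.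
rewrite size_mkseq ltnn; apply.
  by apply/allP => _ /mapP[k _ ->]; rewrite /root g0.
rewrite mkseq_uniq // => k l /addrI /oppr_inj /eqP.
suff nat_inj (u v : nat) : (u <= v)%N -> u%:R == v%:R :> L -> u = v.
  by case: (leqP k l) => [/nat_inj //|/ltnW /nat_inj kl]; rewrite eq_sym => /kl.
move=> uv; rewrite eq_sym -subr_eq0 -natrB // -(rmorph_nat iota) fmorph_eq0.
by rewrite ((pcharf0P K).1 charK) subn_eq0 => vu; apply/eqP; rewrite eqn_leq uv.
Qed.

Lemma clear_denominators (F : fieldType) (q qi qj qij s si sj sij : F) :
    s != 0 -> si != 0 -> sj != 0 -> sij != 0 ->
  q / s - qi / si - qj / sj + qij / sij = 0 ->
  q * si * sj * sij - qi * s * sj * sij - qj * s * si * sij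
  + qij * s * si * sj = 0.
Proof.
move=> t ti tj tij e.
rewrite -[RHS](mul0r (s * si * sj * sij)) -e.
by field; rewrite t ti tj tij.
Qed.

(** The polynomial form can be evaluated anywhere, in particular where one of the denominators
    vanishes; [cancel_pole] depends on this. *)
Lemma tofrac_clear_denominators (A : idomainType)
    (q qi qj qij s si sj sij : A) :
    s != 0 -> si != 0 -> sj != 0 -> sij != 0 ->
  tofrac q / tofrac s - tofrac qi / tofrac si - tofrac qj / tofrac sj
    + tofrac qij / tofrac sij = 0 ->
  q * si * sj * sij - qi * s * sj * sij - qj * s * si * sij
  + qij * s * si * sj = 0.
Proof.
move=> t ti tj tij e; apply/eqP; rewrite -tofrac_eq0.
rewrite tofracD !tofracB !tofracM.
by rewrite (clear_denominators _ _ _ _ e) ?tofrac_eq0.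
Qed.

(** [Delta j f] is fixed by [shift i], hence by its iterates. As shifts commute, [Delta j] kills
    [f - iter k (shift i) f], which is therefore fixed by the iterates of [shift j]. *)
Lemma shift_iter_square i j (f : {fraction {mpoly K[n]}}) k l :
  Delta i (Delta j f) = 0 ->
  f - iter k (shift i) f - iter l (shift j) f
    + iter k (shift i) (iter l (shift j) f) = 0.
Proof.
have iterB (a : 'I_n) m (x y : {fraction {mpoly K[n]}}) :
    iter m (shift a) (x - y) = iter m (shift a) x - iter m (shift a) y.
  by elim: m => [//|m IH]; rewrite !iterS IH (rmorphB (shift a)).
have iterC (a b : 'I_n) m (x : {fraction {mpoly K[n]}}) :
    iter m (shift a) (shift b x) = shift b (iter m (shift a) x).
  by elim: m => [//|m IH]; rewrite !iterS IH shift_comm.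
have iterCC (a b : 'I_n) m m' (x : {fraction {mpoly K[n]}}) :
    iter m (shift a) (iter m' (shift b) x)
    = iter m' (shift b) (iter m (shift a) x).
  by elim: m' => [//|m' IH]; rewrite !iterS -IH iterC.
have iter_fix (a : 'I_n) m (x : {fraction {mpoly K[n]}}) :
    Delta a x = 0 -> iter m (shift a) x = x.
  by move=> /subr0_eq ax; elim: m => //= m ->.
move=> ijf.
have /(iter_fix j l) : Delta j (f - iter k (shift i) f) = 0.
  have := iter_fix i k _ ijf; rewrite /Delta iterB => e.
  rewrite rmorphB /= -iterC.
  have -> (a b c d : {fraction {mpoly K[n]}}) :
    a - b - (c - d) = (a - c) - (b - d) by ring.
  by rewrite e subrr.
rewrite iterB -iterCC => e.
have -> (a b c d : {fraction {mpoly K[n]}}) :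
  a - b - c + d = (a - b) - (c - d) by ring.
by rewrite e subrr.
Qed.

(** For [x = w i - k%:R] and [y = w j - l%:R] this is [shift_iter_square] with denominators cleared,
    evaluated at [w]. The left side is polynomial in [x] and in [y], so the identity extends to all
    [x], then to all [y]. *)
Lemma four_point (L : idomainType) (iota : {rmorphism K -> L}) (i j : 'I_n)
    (q s : {mpoly K[n]}) (w : 'I_n -> L) (x y : L) :
    i != j -> s != 0 -> Delta i (Delta j (tofrac q / tofrac s)) = 0 ->
  let ev p u := mmap iota u p in
  let wi := upd w i x in let wj := upd w j y in let wij := upd wi j y in
  ev q w * ev s wi * ev s wj * ev s wij - ev q wi * ev s w * ev s wj * ev s wij
  - ev q wj * ev s w * ev s wi * ev s wij
  + ev q wij * ev s w * ev s wi * ev s wj = 0.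
Proof.
move=> ij s0 f0 ev.
pose good x y := let wi := upd w i x in let wj := upd w j y in
  let wij := upd wi j y in
  ev q w * ev s wi * ev s wj * ev s wij - ev q wi * ev s w * ev s wj * ev s wij
  - ev q wj * ev s w * ev s wi * ev s wij
  + ev q wij * ev s w * ev s wi * ev s wj = 0.
have good_nat k l : good (w i - k%:R) (w j - l%:R).
  have := shift_iter_square k l f0.
  rewrite !iter_shift_div ?iter_shiftU_eq0 //.
  set qi := iter k (shiftU i) q; set si := iter k (shiftU i) s.
  set qj := iter l _ q; set sj := iter l _ s.
  set qij := iter _ _ qj; set sij := iter _ _ sj => e.
  have : q * si * sj * sij - qi * s * sj * sij - qj * s * si * sij
         + qij * s * si * sj = 0.
    by apply: tofrac_clear_denominators e; rewrite ?iter_shiftU_eq0.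
  move/(congr1 (mmap iota w)).
  rewrite rmorph0 rmorphD /= !rmorphB /= !rmorphM /= /good /ev.
  rewrite !mmap_iter_shiftU.
  suff eqw : upd (upd w i (w i - k%:R)) j (upd w i (w i - k%:R) j - l%:R)
         =1 upd (upd w i (w i - k%:R)) j (w j - l%:R).
    by rewrite !(eq_mmap _ _ eqw).
  by move=> m; rewrite /upd [j == i]eq_sym (negPf ij).
have updC (T : Type) (v : 'I_n -> T) a b :
    upd (upd v i a) j b =1 upd (upd v j b) i a.
  move=> m; rewrite /upd.
  by case: (m =P j) => [->|]; rewrite // eq_sym (negPf ij).
(* The left side, as a function of the [i]-th coordinate, is a polynomial [g] assembled from
   restrictions [sl] to lines; it vanishes at every [w i - k%:R]. *)
have good_i z l : good z (w j - l%:R).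
  pose sl v p := mmap (polyC \o iota) (upd (polyC \o v) i 'X) p.
  set b := w j - l%:R; pose wj := upd w j b.
  pose g := (ev q w)%:P * sl w s * (ev s wj)%:P * sl wj s
    - sl w q * (ev s w)%:P * (ev s wj)%:P * sl wj s
    - (ev q wj)%:P * (ev s w)%:P * sl w s * sl wj s
    + sl wj q * (ev s w)%:P * sl w s * (ev s wj)%:P.
  have gE a : good a b <-> g.[a] = 0.
    rewrite /g !(hornerD, hornerN, hornerM, hornerC) !horner_slice /good /ev.
    by rewrite !(eq_mmap _ _ (updC _ w a b)).
  apply/gE; rewrite (poly_shifts_eq0 iota (a := w i) (g := g)) ?horner0 // => k.
  exact/gE/good_nat.
(* The same argument in the [j]-th coordinate, with the arbitrary [x] now fixed. *)
pose sl v p := mmap (polyC \o iota) (upd (polyC \o v) j 'X) p.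
pose wi := upd w i x.
pose g := (ev q w)%:P * (ev s wi)%:P * sl w s * sl wi s
    - (ev q wi)%:P * (ev s w)%:P * sl w s * sl wi s
    - sl w q * (ev s w)%:P * (ev s wi)%:P * sl wi s
    + sl wi q * (ev s w)%:P * (ev s wi)%:P * sl w s.
have gE a : good x a <-> g.[a] = 0.
  by rewrite /g !(hornerD, hornerN, hornerM, hornerC) !horner_slice.
apply/gE; rewrite (poly_shifts_eq0 iota (a := w j) (g := g)) ?horner0 // => k.
exact/gE/good_i.
Qed.

End FourPoint.

(** * The Vandermonde product and its cofactors *)

Section Vandermonde.

Variable n : nat.

Definition vdm (A : comNzRingType) (x : 'I_n -> A) :=
  \prod_(k < n) \prod_(l < n | (k < l)%N) (x k - x l).

(** The quotient of [vdm x] by the product of all [x j - x k]. Each [k < j] contributes a sign,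
    because [vdm] contains [x k - x j] instead. *)
Definition vdm_cofactor (A : comNzRingType) (j : 'I_n) (x : 'I_n -> A) :=
  \prod_(k < n | k != j)
    ((-1) ^+ (k < j)%N * \prod_(l < n | (l != j) && (k < l)%N) (x k - x l)).

Lemma vdmE (A : comNzRingType) j (x : 'I_n -> A) :
  vdm x = (\prod_(k < n | k != j) (x j - x k)) * vdm_cofactor j x.
Proof.
rewrite /vdm (bigD1 j) //=.
have -> : \prod_(l < n | (j < l)%N) (x j - x l)
    = \prod_(k < n | k != j) (if (j < k)%N then x j - x k else 1).
  rewrite -big_mkcondr; apply: eq_bigl => k.
  by case: (ltngtP j k) => [jk|jk|/val_inj->]; rewrite ?eqxx ?andbF ?andbT //;
     apply/esym/eqP => kj; rewrite kj ltnn in jk.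
rewrite /vdm_cofactor -!big_split /=; apply: eq_bigr => k kj.
rewrite mulrA.
have [lt_kj|le_jk] := boolP (k < j)%N.
  rewrite (bigD1 j) //= ltnNge (ltnW lt_kj) /= mul1r expr1 mulrN1 opprB.
  by congr (_ * _); apply: eq_bigl => l; rewrite andbC.
have -> : (j < k)%N by rewrite ltn_neqAle leqNgt le_jk andbT eq_sym.
rewrite expr0 mulr1; congr (_ * _); apply: eq_bigl => l.
by case: eqP => // ->; rewrite (negPf le_jk).
Qed.

Lemma vdm_neq0 (A : idomainType) (x : 'I_n -> A) :
  (forall k l, k != l -> x k != x l) -> vdm x != 0.
Proof.
move=> xP; apply/prodf_neq0 => k _; apply/prodf_neq0 => l kl.
by rewrite subr_eq0 xP //; apply: contraL kl => /eqP->; rewrite ltnn.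
Qed.

(** The cofactor does not involve [x j], so it is constant along lines on which only the [j]-th
    coordinate varies. *)
Lemma eq_vdm_cofactor (A : comNzRingType) j (x y : 'I_n -> A) :
  (forall k, k != j -> x k = y k) -> vdm_cofactor j x = vdm_cofactor j y.
Proof.
move=> xy; apply: eq_bigr => k kj; congr (_ * _); apply: eq_bigr => l.
by case/andP=> lj _; rewrite !xy.
Qed.

Variable K : fieldType.
Local Notation X := (fun k : 'I_n => 'X_k : {mpoly K[n]}).

Lemma mmap_vdm (A : comNzRingType) (iota : {rmorphism K -> A}) w :
  mmap iota w (vdm X) = vdm w.
Proof.
rewrite rmorph_prod; apply: eq_bigr => k _; rewrite rmorph_prod /=.
by apply: eq_bigr => l _; rewrite rmorphB /= !mmapXi.
Qed.

Lemma mmap_vdm_cofactor (A : comNzRingType) (iota : {rmorphism K -> A}) j w :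
  mmap iota w (vdm_cofactor j X) = vdm_cofactor j w.
Proof.
rewrite rmorph_prod; apply: eq_bigr => k _.
rewrite rmorphM rmorphXn rmorphN1 rmorph_prod /=; congr (_ * _).
by apply: eq_bigr => l _; rewrite rmorphB /= !mmapXi.
Qed.

End Vandermonde.

(** * Reduction of the poles to the Vandermonde product *)

Section Poles.

Variables (K : fieldType) (n : nat).
Local Notation X := (fun k : 'I_n => 'X_k : {mpoly K[n]}).

(** These points avoid every hyperplane on which an element of [Ubar] may have a pole. *)
Definition separated (L : nzRingType) (w : 'I_n -> L) :=
  forall k l (a : int), k != l -> w k - w l + a%:~R != 0.

Lemma mmap_denominator_neq0 (L : idomainType) (iota : {rmorphism K -> L}) w
    (s : {mpoly K[n]}) :
  separated w -> denominator s -> mmap iota w s != 0.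
Proof.
move=> wP; elim=> [|i j a t ij _ t0]; first by rewrite rmorph1 oner_eq0.
rewrite rmorphM mulf_neq0 //= rmorphD rmorphB rmorph_int /= !mmapXi.
exact: wP.
Qed.

Lemma separated_vdm_neq0 (L : idomainType) (w : 'I_n -> L) :
  separated w -> vdm w != 0.
Proof.
move=> wP; apply: vdm_neq0 => k l kl; rewrite -subr_eq0.
by have := wP k l 0 kl; rewrite addr0.
Qed.

Lemma mcoeff_U_int (t : 'I_n) (a : int) : (a%:~R : {mpoly K[n]})@_U_(t) = 0.
Proof. by rewrite -(rmorph_int (@mpolyC n K)) mcoeffC mnm1_eq0 mulr0. Qed.

(** Adding an integer does not change linear coefficients. *)
Lemma separated_mcoeff (w : 'I_n -> {mpoly K[n]}) :
  (forall k l, k != l -> exists t, (w k)@_U_(t) != (w l)@_U_(t)) -> separated w.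
Proof.
move=> wP k l a kl; have [t] := wP k l kl; apply: contraNneq.
move/(congr1 (mcoeff U_(t))).
by rewrite mcoeffD mcoeffB mcoeff_U_int addr0 mcoeff0 => /subr0_eq ->.
Qed.

Lemma separated_X : separated X.
Proof.
apply: separated_mcoeff => k l kl; exists k.
by rewrite !mcoeffXU eqxx [l == k]eq_sym (negPf kl) oner_eq0.
Qed.

(** The substitution is reduction modulo ['X_i - 'X_j + a%:~R]: the polynomials that satisfy the
    congruence contain the constants and the variables and are closed under sums and products. *)
Lemma mmap_upd_modulo i j (a : int) (p : {mpoly K[n]}) :
  exists r, p - mmap (@mpolyC n K) (upd X j ('X_i + a%:~R)) p
    = ('X_i - 'X_j + a%:~R) * r.
Proof.
set f := mmap _ _; set d := 'X_i - _ + _.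
pose P q := exists r, q - f q = d * r.
have PD q1 q2 : P q1 -> P q2 -> P (q1 + q2).
  move=> [r1 e1] [r2 e2]; exists (r1 + r2).
  by rewrite /f raddfD /= mulrDr -e1 -e2 opprD addrACA.
have PM q1 q2 : P q1 -> P q2 -> P (q1 * q2).
  move=> [r1 e1] [r2 e2]; exists (r1 * q2 + f q1 * r2).
  rewrite mulrDr mulrA -e1 mulrCA -e2 /f rmorphM /= mulrBl mulrBr addrA.
  by rewrite subrK.
have PC c : P c%:MP by exists 0; rewrite /f mmapC subrr mulr0.
have PX k : P 'X_k.
  rewrite /P /f mmapXi /upd; case: eqP => [->|_].
    by exists (-1); rewrite mulrN1 /d !opprD opprK addrA ['X_j - _]addrC.
  by exists 0; rewrite subrr mulr0.
have P1 : P 1 by rewrite -mpolyC1.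
elim/mpolyind: p => [|c m p _ _ IH]; first by rewrite -mpolyC0; exact: PC.
apply: PD IH; rewrite -mul_mpolyC; apply: (PM _ _ (PC c)).
rewrite mpolyXE_id; apply: big_ind => // k _.
by elim: (m k) => [//|e IHe]; rewrite exprS; apply: PM.
Qed.

Hypothesis charK : [pchar K] =i pred0.

(* The four-point identity expresses [(h i - h j) * sigma] on the hyperplane
   [h j = h i + a] through its values at points off the poles. *)
Lemma cancel_pole (sigma : {fraction {mpoly K[n]}}) i j (a : int) p s :
    Delta i (Delta j ((h K i - h K j) * sigma)) = 0 ->
    i != j -> denominator s ->
    sigma = tofrac p / tofrac (('X_i - 'X_j + a%:~R) * s * vdm X) ->
  exists p', sigma = tofrac p' / tofrac (s * vdm X).
Proof.
move=> eqs ij ds sE; set d := 'X_i - 'X_j + a%:~R in sE.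
(* Multiplying [sigma] by [h K i - h K j] cancels one factor of [vdm X]. With [V] left in the
   denominator, the numerator is [p] itself, so no information is lost on the hyperplane even when
   [a = 0]. *)
pose V := (\prod_(k < n | (k != i) && (k != j)) ('X_i - 'X_k))
   * vdm_cofactor i X : {mpoly K[n]}.
have VE : vdm X = ('X_i - 'X_j) * V.
  by rewrite (vdmE i) (bigD1 j) 1?eq_sym //= mulrA.
have ds' : denominator (d * s) by exact: denominatorM.
have d0 : d != 0.
  by have := denominator_neq0 ds'; rewrite mulf_eq0 negb_or => /andP[].
have evD (w : 'I_n -> {mpoly K[n]}) :
    separated w -> mmap (@mpolyC n K) w (d * s * V) != 0.
  move=> wP; have := mulf_neq0 (mmap_denominator_neq0 (@mpolyC n K) wP ds')
    (separated_vdm_neq0 wP).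
  rewrite -(mmap_vdm (@mpolyC n K)) -rmorphM VE mulrCA rmorphM /=.
  rewrite mulf_eq0 negb_or.
  by case/andP.
have D0 : d * s * V != 0 by have := evD X separated_X; rewrite mmap_id.
have Xij0 : 'X_i - 'X_j != 0 :> {mpoly K[n]}.
  by have := @separated_X i j 0 ij; rewrite addr0.
have fE : (h K i - h K j) * sigma = tofrac p / tofrac (d * s * V).
  rewrite sE VE /h -tofracB (mulrCA (d * s)) (tofracM ('X_i - 'X_j)).
  by rewrite invfM mulrCA mulVKf ?tofrac_eq0.
rewrite fE in eqs.
(* The base point [w] is generic on the hyperplane [d = 0]. The new coordinates make [wj] the
   generic point and give [wi] and [wij] pairwise different linear parts, so these three points are
   separated. *)
have /= := four_point charK (@mpolyC n K) (upd X j ('X_i + a%:~R))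
  ('X_j *+ 2) 'X_j ij D0 eqs.
set w := upd X j _; set wi := upd w i _.
set wj := upd w j _; set wij := upd wi j _.
have Dw : mmap (@mpolyC n K) w (d * s * V) = 0.
  rewrite !rmorphM /d rmorphD rmorphB /= rmorph_int !mmapXi /w /upd eqxx.
  by rewrite (negPf ij) opprD addrA subrr sub0r addNr !mul0r.
have neqji : (j == i) = false by rewrite eq_sym (negPf ij).
have Dwj : mmap (@mpolyC n K) wj (d * s * V) != 0.
  suff /eq_mmap -> : wj =1 X by apply: evD; exact: separated_X.
  by move=> k; rewrite /wj /w /upd; case: eqP => [->|].
have Dwi : mmap (@mpolyC n K) wi (d * s * V) != 0.
  apply: evD; apply: separated_mcoeff => k l.
  rewrite /wi /w /upd.
  have [ki|ki] := eqVneq k i; have [li|li] := eqVneq l i; rewrite /=.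
  - by rewrite ki li eqxx.
  - have [lj _|lj _] := eqVneq l j; [exists i|exists l]; rewrite /=.
      by rewrite mcoeffMn mcoeffD !mcoeffXU
        mcoeff_U_int neqji eqxx mul0rn addr0 eq_sym oner_eq0.
    by rewrite mcoeffMn !mcoeffXU eqxx [j == l]eq_sym (negPf lj)
         mul0rn eq_sym oner_eq0.
  - have [kj _|kj _] := eqVneq k j; [exists i|exists k]; rewrite /=.
      by rewrite mcoeffMn mcoeffD !mcoeffXU
        mcoeff_U_int neqji eqxx mul0rn addr0 oner_eq0.
    by rewrite mcoeffMn !mcoeffXU eqxx [j == k]eq_sym (negPf kj) mul0rn oner_eq0.
  have [kj|kj] := eqVneq k j; have [lj|lj] := eqVneq l j; rewrite /= => kl.
  - by rewrite kj lj eqxx in kl.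
  - by exists l; rewrite mcoeffD !mcoeffXU
      mcoeff_U_int eqxx [i == l]eq_sym (negPf li) addr0 eq_sym oner_eq0.
  - by exists k; rewrite mcoeffD !mcoeffXU
      mcoeff_U_int eqxx [i == k]eq_sym (negPf ki) addr0 oner_eq0.
  by exists k; rewrite !mcoeffXU eqxx [l == k]eq_sym (negPf kl) oner_eq0.
have Dwij : mmap (@mpolyC n K) wij (d * s * V) != 0.
  apply: evD; apply: separated_mcoeff => k l.
  rewrite /wij /wi /w /upd.
  have two1 : 2%:R != 1 :> K.
    by rewrite -subr_eq0 -[1 in X in _ - X]/(1%:R) -natrB // oner_eq0.
  have [kj|kj] := eqVneq k j; have [lj|lj] := eqVneq l j; rewrite /=.
  - by rewrite kj lj eqxx.
  - have [li _|li _] := eqVneq l i; [exists j|exists l]; rewrite /=.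
      by rewrite mcoeffMn !mcoeffXU eqxx eq_sym.
    by rewrite !mcoeffXU eqxx [j == l]eq_sym (negPf lj) eq_sym oner_eq0.
  - have [ki _|ki _] := eqVneq k i; [exists j|exists k]; rewrite /=.
      by rewrite mcoeffMn !mcoeffXU eqxx.
    by rewrite !mcoeffXU eqxx [j == k]eq_sym (negPf kj) oner_eq0.
  have [ki|ki] := eqVneq k i; have [li|li] := eqVneq l i; rewrite /= => kl.
  - by rewrite ki li eqxx in kl.
  - by exists l; rewrite mcoeffMn !mcoeffXU eqxx [j == l]eq_sym (negPf lj)
         mul0rn eq_sym oner_eq0.
  - by exists k; rewrite mcoeffMn !mcoeffXU eqxx [j == k]eq_sym (negPf kj)
         mul0rn oner_eq0.
  by exists k; rewrite !mcoeffXU eqxx [l == k]eq_sym (negPf kl) oner_eq0.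
(* The denominator vanishes at [w], so only the term with the value of [p] at [w] survives. That
   value is thus 0, and [d] divides [p]. *)
rewrite Dw !(mulr0, mul0r) !subr0 addr0 => /eqP.
rewrite !mulf_eq0 (negPf Dwi) (negPf Dwj) (negPf Dwij) !orbF => /eqP pw.
have [r] := mmap_upd_modulo i j a p; rewrite -/w pw subr0 -/d => pE.
exists r; rewrite sE pE -mulrA (tofracM d r) (tofracM d (s * _)).
by rewrite -mulf_div divff ?tofrac_eq0 // mul1r.
Qed.

(** After expanding the fraction by [vdm X], induction on the denominator removes its linear factors
    one at a time by [cancel_pole]. *)
Lemma solution_vdm_denominator (sigma : {fraction {mpoly K[n]}}) :
    (forall i j, Delta i (Delta j ((h K i - h K j) * sigma)) = 0) ->
    Ubar sigma ->
  exists p, sigma = tofrac p / tofrac (vdm X).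
Proof.
move=> eqs [p [s [ds sE]]].
have V0 := separated_vdm_neq0 separated_X.
have {sE} : sigma = tofrac (p * vdm X) / tofrac (s * vdm X).
  by rewrite sE !tofracM -mulf_div divff ?tofrac_eq0 // mulr1.
elim: ds (p * _) => [|i j a t ij dt IH] q sE.
  by exists q; rewrite sE mul1r.
by have [q' /IH] := cancel_pole (eqs i j) ij dt sE.
Qed.

End Poles.

(** * The linear system and the solutions coming from partial fractions *)

Lemma subACA (V : zmodType) (a b c d : V) : a - b - (c - d) = a - c - (b - d).
Proof. by rewrite !opprD !opprK addrACA. Qed.

Section Solutions.

Variables (K : fieldType) (n : nat).
Local Notation F := {fraction {mpoly K[n]}}.
Local Notation X := (fun k : 'I_n => 'X_k : {mpoly K[n]}).

Definition solution (x : F) :=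
  forall i j : 'I_n, Delta i (Delta j ((h K i - h K j) * x)) = 0.

Lemma Delta0 j : Delta j (0 : F) = 0.
Proof. by rewrite /Delta raddf0 subrr. Qed.

Lemma shiftB i (x y : F) : shift i (x - y) = shift i x - shift i y.
Proof. exact: rmorphB. Qed.

Lemma DeltaB j (x y : F) : Delta j (x - y) = Delta j x - Delta j y.
Proof. by rewrite /Delta shiftB subACA. Qed.

Lemma DeltaN j (x : F) : Delta j (- x) = - Delta j x.
Proof. by rewrite -sub0r DeltaB Delta0 sub0r. Qed.

Lemma Delta_comm i j (x : F) : Delta i (Delta j x) = Delta j (Delta i x).
Proof. by rewrite /Delta !shiftB (shift_comm i j) subACA. Qed.

Lemma Delta_fixed j (x : F) : shift j x = x -> Delta j x = 0.
Proof. by rewrite /Delta => ->; rewrite subrr. Qed.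

Local Opaque Delta.

Lemma solutionB (x y : F) : solution x -> solution y -> solution (x - y).
Proof.
by move=> sx sy i j; rewrite mulrBr (DeltaB j) (DeltaB i) sx sy subrr.
Qed.

Lemma solution_sum (I : finType) (f : I -> F) :
  (forall i, solution (f i)) -> solution (\sum_i f i).
Proof.
have s0 : solution 0 by move=> i j; rewrite mulr0 !Delta0.
move=> sf; apply: big_ind => [|x y sx sy|i _]; [exact: s0 | | exact: sf].
by have := solutionB sx (solutionB s0 sy); rewrite sub0r opprK.
Qed.

Lemma mmap_horner_alg (A : comNzRingType) (iota : {rmorphism K -> A}) w j p :
  mmap iota w (horner_alg ('X_j : {mpoly K[n]}) p) = (map_poly iota p).[w j].
Proof.
rewrite /horner_alg /horner_morph -horner_map /= mmapXi; congr (_.[_]).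
rewrite -map_poly_comp; apply: eq_map_poly => c /=.
by rewrite mmapZ rmorph1 mulr1.
Qed.

Lemma shift_eval_h i j (p : {poly K}) : i != j ->
  shift i (eval_h (n := n) p j) = eval_h p j.
Proof.
move=> ij; rewrite shift_tofrac; congr tofrac.
rewrite -[LHS]mmap_id mmap_shiftU -[RHS]mmap_id !mmap_horner_alg.
by rewrite /upd eq_sym (negPf ij).
Qed.

Lemma shift_hB i j k : i != j -> i != k ->
  shift i (h K j - h K k : F) = h K j - h K k.
Proof.
move=> ij ik; rewrite rmorphB /= !shift_h.
by rewrite ![_ == i]eq_sym (negPf ij) (negPf ik) !subr0.
Qed.

Lemma hB_neq0 i j : i != j -> h K i - h K j != 0 :> F.
Proof.
move=> ij; rewrite -tofracB tofrac_eq0.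
by have := @separated_X K n i j 0 ij; rewrite addr0.
Qed.

Lemma chi_tofrac j :
  chi K j = tofrac (\prod_(k < n | k != j) ('X_j - 'X_k)) :> F.
Proof.
by rewrite rmorph_prod; apply: eq_bigr => k _; rewrite rmorphB.
Qed.

Lemma chi_neq0 j : chi K j != 0 :> F.
Proof. by apply/prodf_neq0 => k kj; rewrite hB_neq0 // eq_sym. Qed.

Lemma tofrac_vdm j :
  tofrac (vdm X) = chi K j * tofrac (vdm_cofactor j X) :> F.
Proof. by rewrite chi_tofrac -tofracM -vdmE. Qed.

Lemma eval_h_Ubar j (p : {poly K}) : Ubar (eval_h (n := n) p j / chi K j).
Proof.
exists (horner_alg 'X_j p), (\prod_(k < n | k != j) ('X_j - 'X_k)).
split; last by rewrite chi_tofrac.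
elim/big_rec: _ => [|k s kj ds]; first exact: denominator1.
have jk : j != k by rewrite eq_sym.
by have := denominatorM 0 jk ds; rewrite addr0.
Qed.

Lemma partial_fraction (E : fieldType) (e a b c : E) : a != 0 -> b != 0 ->
  (b - a) * (e / (a * (b * c))) = e / (a * c) - e / (b * c).
Proof.
(* For [c = 0] both sides are 0, since the inverse of 0 is 0. *)
move=> a0 b0; have [->|c0] := eqVneq c 0.
  by rewrite !mulr0 invr0 !mulr0 subrr.
by field; rewrite a0 b0 c0.
Qed.

(** If [k] is [i] or [j], the factor [h K i - h K j] cancels in [chi K k] up to sign, and the other
    variable disappears. Otherwise, writing the factor as [(h K k - h K j) - (h K k - h K i)] splits
    the product into a term free of [h K j] and one free of [h K i]; the corresponding difference
    operators kill them. *)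
Lemma solution_Wj k (p : {poly K}) : solution (eval_h p k / chi K k).
Proof.
have shift_prod j (P : pred 'I_n) : (forall l, P l -> l != j) -> k != j ->
    shift j (\prod_(l < n | P l) (h K k - h K l))
    = \prod_(l < n | P l) (h K k - h K l).
  move=> Pj kj; rewrite rmorph_prod; apply: eq_bigr => l Pl /=.
  by rewrite shift_hB // eq_sym // Pj.
have shift_quot j (P : pred 'I_n) : (forall l, P l -> l != j) -> k != j ->
    shift j (eval_h p k / \prod_(l < n | P l) (h K k - h K l))
    = eval_h p k / \prod_(l < n | P l) (h K k - h K l).
  move=> Pj kj; rewrite rmorphM fmorphV /= shift_prod // shift_eval_h //.
  by rewrite eq_sym.
have fixed j : j != k ->
    Delta j ((h K k - h K j) * (eval_h p k / chi K k)) = 0.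
  move=> jk; apply: Delta_fixed; have kj : k != j by rewrite eq_sym.
  rewrite /chi (bigD1 j) //= invfM mulrCA mulVKf ?hB_neq0 //.
  by rewrite shift_quot // => l /andP[].
move=> i j; have [<-|ij] := eqVneq i j; first by rewrite subrr mul0r !Delta0.
have [->|ik] := eqVneq i k.
  have [->|jk] := eqVneq j k; first by rewrite subrr mul0r !Delta0.
  by rewrite fixed // Delta0.
have [->|jk] := eqVneq j k.
  by rewrite Delta_comm -opprB mulNr (DeltaN i) fixed // oppr0 Delta0.
have ki : k != i by rewrite eq_sym.
have kj : k != j by rewrite eq_sym.
have ji : j != i by rewrite eq_sym.
pose c := \prod_(l < n | [&& l != k, l != i & l != j]) (h K k - h K l) : F.
have chiE : chi K k = (h K k - h K i) * ((h K k - h K j) * c).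
  rewrite /chi (bigD1 i) //= (bigD1 j) /=; last by rewrite jk ji.
  by congr (_ * (_ * _)); apply: eq_bigl => l; rewrite andbA.
have -> : h K i - h K j = (h K k - h K j) - (h K k - h K i) :> F.
  by rewrite opprB [RHS]addrC subrKA.
rewrite chiE partial_fraction ?hB_neq0 // (DeltaB j) (DeltaB i).
have -> : (h K k - h K i) * c
    = \prod_(l < n | (l != k) && (l != j)) (h K k - h K l).
  by rewrite [RHS](bigD1 i) /= ?ik //; congr (_ * _); apply: eq_bigl => l;
     rewrite -andbA [(l != j) && _]andbC.
have -> : (h K k - h K j) * c
    = \prod_(l < n | (l != k) && (l != i)) (h K k - h K l).
  by rewrite [RHS](bigD1 j) /= ?jk //; congr (_ * _); apply: eq_bigl => l;
     rewrite -andbA.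
have zero m : k != m ->
    Delta m (eval_h p k
      / \prod_(l < n | (l != k) && (l != m)) (h K k - h K l)) = 0.
  by move=> km; apply/Delta_fixed/shift_quot => // l /andP[].
by rewrite zero // Delta0 sub0r Delta_comm zero // Delta0 oppr0.
Qed.

End Solutions.

Local Opaque Delta.

(** * Interpolation from lines through a constant point *)

Lemma divfMr (E : fieldType) (x y z : E) : z != 0 -> x * z / (y * z) = x / y.
Proof. by move=> z0; rewrite invfM mulrACA divff ?mulr1. Qed.

Section Interpolation.

Variables (K : fieldType) (n : nat).
Hypothesis charK : [pchar K] =i pred0.
Local Notation F := {fraction {mpoly K[n]}}.
Local Notation X := (fun k : 'I_n => 'X_k : {mpoly K[n]}).
Local Notation c := (fun k : 'I_n => (k : nat)%:R : K).

Lemma node_inj (k l : 'I_n) : k != l -> c k != c l.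
Proof.
suff lt_neq (a b : nat) : (a < b)%N -> a%:R != b%:R :> K.
  rewrite -val_eqE /= neq_ltn => /orP[/lt_neq // | /lt_neq].
  by rewrite eq_sym.
move=> ab; rewrite eq_sym -subr_eq0 -natrB ?(ltnW ab) //.
by rewrite ((pcharf0P K).1 charK) subn_eq0 -ltnNge.
Qed.

(** As [S] grows, this passes from the constant point [c] to the generic point, which allows
    induction on the size of [S]. *)
Definition mixed_point (S : {set 'I_n}) (k : 'I_n) : {mpoly K[n]} :=
  if k \in S then 'X_k else (c k)%:MP.

Lemma mixed_point_inj S k l : k != l -> mixed_point S k != mixed_point S l.
Proof.
rewrite /mixed_point => kl.
have X_neq (k1 l1 : 'I_n) : k1 != l1 ->
    ('X_k1 : {mpoly K[n]}) != (if l1 \in S then 'X_l1 else (c l1)%:MP).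
  move=> kl1; apply/eqP => /(congr1 (mcoeff U_(k1))).
  rewrite mcoeffXU eqxx; case: ifP => _.
    by rewrite mcoeffXU eq_sym (negPf kl1) => /eqP; rewrite oner_eq0.
  by rewrite mcoeffC mnm1_eq0 mulr0 => /eqP; rewrite oner_eq0.
case kS: (k \in S); first exact: X_neq.
case lS: (l \in S).
  have lk : l != k by rewrite eq_sym.
  by rewrite eq_sym; have := X_neq l k lk; rewrite kS.
by rewrite mpolyC_eq node_inj.
Qed.

(** The four-point identity reduces the value at [mixed_point S] to the values where [i], [j] or
    both leave [S]. Sets with at most one element give points on a line through [c], covered by the
    hypothesis; the full set gives [p]. *)
Lemma vanish_on_mixed_points (p : {mpoly K[n]}) (j0 : 'I_n) :
    solution (tofrac p / tofrac (vdm X)) ->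
    (forall j (w : 'I_n -> {mpoly K[n]}),
       (forall k, k != j -> w k = (c k)%:MP) -> mmap (@mpolyC n K) w p = 0) ->
  p = 0.
Proof.
move=> solp base.
have V0 : vdm X != 0 by apply: separated_vdm_neq0; exact: separated_X.
suff van m (S : {set 'I_n}) : (#|S| <= m)%N ->
    mmap (@mpolyC n K) (mixed_point S) p = 0.
  rewrite -(van _ [set: 'I_n] (leqnn _)) -[LHS]mmap_id.
  by apply: eq_mmap => k; rewrite /mixed_point inE.
elim: m S => [|m IH] S Sm.
  apply: (base j0) => k _; rewrite leqn0 cards_eq0 in Sm.
  by rewrite /mixed_point (eqP Sm) inE.
(* Such a point lies on the line in the direction of the element of [S], or on the line in direction
   [j0] if [S] is empty. *)
have [S1|] := leqP #|S| 1.
  have [j Sj] : exists j, S \subset [set j].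
    have [->|[j jS]] := set_0Vmem S; first by exists j0; rewrite sub0set.
    exists j; apply/subsetP => k kS; rewrite inE.
    by have /card_le1P/(_ j jS k) := S1; rewrite kS inE => <-.
  apply: (base j) => k kj; rewrite /mixed_point ifN //.
  by apply: contra kj => /(subsetP Sj); rewrite inE.
case/card_gt1P => i [j [iS jS ij]].
have fE : (h K i - h K j) * (tofrac p / tofrac (vdm X))
    = tofrac (('X_i - 'X_j) * p) / tofrac (vdm X).
  by rewrite tofracM tofracB mulrA.
have f0 := solp i j; rewrite fE in f0.
(* Moving the coordinates [i] and [j] to their nodes yields mixed points of smaller sets, where [p]
   vanishes by induction. *)
have /= := four_point charK (@mpolyC n K) (mixed_point S) (c i)%:MP (c j)%:MP
  ij V0 f0.
have upd_mixed (T : {set 'I_n}) k (w : 'I_n -> {mpoly K[n]}) :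
    w =1 mixed_point T -> upd w k (c k)%:MP =1 mixed_point (T :\ k).
  move=> wT l; rewrite /upd wT /mixed_point in_setD1.
  by case: eqP => [->|].
have zero k (T : {set 'I_n}) (w : 'I_n -> {mpoly K[n]}) : k \in S ->
    w =1 mixed_point T -> T \subset S :\ k ->
    mmap (@mpolyC n K) w (('X_i - 'X_j) * p) = 0.
  move=> kS wT TS; rewrite rmorphM /= (eq_mmap _ p wT) IH ?mulr0 //.
  rewrite (leq_trans (subset_leq_card TS)) //.
  by rewrite (cardsD1 k S) kS in Sm.
have wi := upd_mixed S i _ (frefl _).
have wj := upd_mixed S j _ (frefl _).
have wij := upd_mixed _ j _ wi.
rewrite (zero i _ _ iS wi) // (zero j _ _ jS wj) //.
rewrite (zero i _ _ iS wij) ?subD1set // !mul0r !subr0 addr0 => /eqP.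
have Vw (T : {set 'I_n}) (w : 'I_n -> {mpoly K[n]}) : w =1 mixed_point T ->
    mmap (@mpolyC n K) w (vdm X) != 0.
  move=> wT; rewrite (eq_mmap _ _ wT) mmap_vdm.
  by apply: vdm_neq0 => k l; apply: mixed_point_inj.
rewrite !mulf_eq0 (negPf (Vw _ _ wi)) (negPf (Vw _ _ wj)) (negPf (Vw _ _ wij)).
rewrite !orbF rmorphM rmorphB /= !mmapXi mulf_eq0 subr_eq0.
by rewrite (negPf (mixed_point_inj S ij)) => /eqP.
Qed.

(** Over the common denominator [vdm X], the summand at [j] has numerator [pi j] at ['X_j] times the
    cofactor [N j]. The [pi j] are chosen so that the difference of numerators vanishes on every
    line through [c]; [vanish_on_mixed_points] then makes it 0. *)
Lemma solution_W (j0 : 'I_n) (P : {mpoly K[n]}) :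
    solution (tofrac P / tofrac (vdm X)) ->
  exists pi : 'I_n -> {poly K},
    tofrac P / tofrac (vdm X) = \sum_(j < n) eval_h (pi j) j / chi K j.
Proof.
move=> solP.
pose N j : {mpoly K[n]} := vdm_cofactor j X.
pose Nc j : K := mmap idfun c (N j).
have Nc0 j : Nc j != 0.
  have : vdm c != 0 by apply: vdm_neq0 => k l; apply: node_inj.
  by rewrite (vdmE j) mulf_eq0 negb_or /Nc /N mmap_vdm_cofactor => /andP[].
(* Subtracting a multiple of [1 / chi j0] makes the numerator vanish at the
   node [c]; the polynomials [pi0 j] then do not interfere with each other on
   the lines through [c]. *)
pose kappa := mmap idfun c P / Nc j0.
pose P0 := P - kappa%:MP * N j0.
have P0c : mmap idfun c P0 = 0.
  by rewrite /P0 rmorphB rmorphM /= mmapC -/(Nc _) /kappa divfK ?subrr.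
(* The restriction of [P0] to the line through [c] in direction [j], divided by the constant value
   of [N j] on that line. *)
pose pi0 j : {poly K} := (Nc j)^-1 *: mmap polyC (upd (polyC \o c) j 'X) P0.
pose R := P0 - \sum_(j < n) horner_alg 'X_j (pi0 j) * N j.
have VE j (p : {poly K}) :
    tofrac (horner_alg 'X_j p * N j) / tofrac (vdm X) = eval_h p j / chi K j.
  have V0 : tofrac (vdm X) != 0.
    by rewrite tofrac_eq0; apply: separated_vdm_neq0; exact: separated_X.
  rewrite (tofrac_vdm K j) in V0 *; rewrite tofracM; apply: divfMr.
  by move: V0; rewrite mulf_eq0 negb_or => /andP[].
(* The subtracted multiple of [1 / chi K j0] is put back. *)
pose pi j := pi0 j + (if j == j0 then kappa%:P else 0).
have RE : tofrac R / tofrac (vdm X)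
    = tofrac P / tofrac (vdm X) - \sum_(j < n) eval_h (pi j) j / chi K j.
  have -> : R = P - \sum_(j < n) horner_alg 'X_j (pi j) * N j.
    rewrite /R /P0 -addrA -opprD; congr (_ - _).
    under [RHS]eq_bigr do rewrite /pi rmorphD /= mulrDl.
    rewrite big_split /= addrC; congr (_ + _).
    rewrite (bigD1 j0) //= eqxx horner_algC big1 ?addr0.
      by rewrite -mul_mpolyC mulr1.
    by move=> j /negPf->; rewrite rmorph0 mul0r.
  rewrite tofracB mulrBl rmorph_sum mulr_suml; congr (_ - _).
  by apply: eq_bigr => j _; exact: VE.
suff R0 : R = 0.
  by exists pi; apply/eqP; rewrite -subr_eq0 -RE R0 tofrac0 mul0r.
apply: (vanish_on_mixed_points j0).
  rewrite RE; apply: (solutionB solP); apply: solution_sum => j.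
  exact: solution_Wj.
move=> j w wc.
have cE (f : {mpoly K[n]}) :
    mmap (@mpolyC n K) (@mpolyC n K \o c) f = (mmap idfun c f)%:MP.
  by rewrite -(rmorph_mmap (iA := idfun) (iB := @mpolyC n K)).
have piE k : mmap (@mpolyC n K) w (horner_alg 'X_k (pi0 k))
    = ((Nc k)^-1)%:MP * mmap (@mpolyC n K) (upd (@mpolyC n K \o c) k (w k)) P0.
  rewrite mmap_horner_alg /pi0 map_polyZ hornerZ; congr (_ * _).
  rewrite -[RHS]horner_slice; congr (_.[_]).
  rewrite (rmorph_mmap (iB := polyC \o @mpolyC n K)).
    apply: eq_mmap => l; rewrite /upd /=.
    by case: eqP => _; rewrite ?map_polyX ?map_polyC.
  by move=> a /=; rewrite map_polyC.
(* For [k != j] the coordinate [w k] is the node [c k], where [pi0 k] vanishes because [P0] vanishes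
   at [c]. The term at [j] reproduces [P0] on the line. *)
rewrite rmorphB rmorph_sum (bigD1 j) //= big1 => [|k kj]; last first.
  rewrite rmorphM /= piE (_ : mmap _ _ P0 = 0) ?mulr0 ?mul0r //.
  rewrite -mpolyC0 -P0c -cE; apply: eq_mmap => l.
  by rewrite /upd; case: eqP => // ->; exact: wc.
rewrite addr0 rmorphM /= piE.
have -> : mmap (@mpolyC n K) w (N j) = (Nc j)%:MP.
  rewrite -cE !mmap_vdm_cofactor; exact: eq_vdm_cofactor.
rewrite mulrAC -mpolyCM mulVf // mul1r.
suff /eq_mmap -> : upd (@mpolyC n K \o c) j (w j) =1 w by rewrite subrr.
by move=> k; rewrite /upd; case: eqP => [->|/eqP /wc].
Qed.

End Interpolation.

(** * Characterization of the solution space *)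

Theorem theorem3p3 (K : fieldType) (charK : [pchar K] =i pred0)
    (n : nat) (n_gt0 : (0 < n)%N)
    (sigma : {fraction {mpoly K[n]}}) (sigmaU : Ubar sigma) :
  ((forall i j : 'I_n, Delta i (Delta j ((h K i - h K j) * sigma)) = 0)
     <-> W sigma)
  /\ (W sigma <-> exists pi : 'I_n -> {poly K},
        sigma = \sum_(j < n) eval_h (pi j) j / chi K j).
Proof.
have WE : W sigma <-> exists pi : 'I_n -> {poly K},
    sigma = \sum_(j < n) eval_h (pi j) j / chi K j.
  split=> [[w [Ww ->]]|[pi ->]].
    have /fin_all_exists[pi wE] j := (Ww j).2.
    by exists pi; apply: eq_bigr.
  exists (fun j => eval_h (pi j) j / chi K j); split=> // j.
  by split; [exact: eval_h_Ubar | exists (pi j)].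
split=> //; split=> [sol|/WE[pi ->]]; last first.
  by apply: solution_sum => j; exact: solution_Wj.
have [p sE] := solution_vdm_denominator charK sol sigmaU.
apply/WE; rewrite sE in sol *.
exact: (solution_W charK (Ordinal n_gt0) sol).
Qed.
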